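(* Let $n\geq 3$ and $s\geq 1$ be integers, and let $a,b\in\{0,1,\ldots,n-1\}$, viewed as elements of $\mathbb{Z}_n$, with $a^2=1$ in $\mathbb{Z}_n$. Then the subgroup of the Riordan group $\mathcal{R}(\mathbb{Z}_n)$ generated by the two elements $$r_1=\left(\frac{a}{(1+(b+1)t)^s},\ \frac{(n-1)t}{1+(b+1)t}\right)\quad\text{and}\quad r_2=\left(\frac{a}{(1+bt)^s},\ \frac{(n-1)t}{1+bt}\right)$$ is isomorphic to the dihedral group $\mathcal{D}_n$ of order $2n$.
   Context: $\mathbb{Z}_n$ denotes the ring of integers modulo $n$. The Riordan group $\mathcal{R}(\mathbb{Z}_n)$ is the set of pairs $(g(t),f(t))$ of formal power series in $\mathbb{Z}_n[[t]]$ such that $g(0)$ is a unit of $\mathbb{Z}_n$, $f(0)=0$, and $f'(0)$ is a unit of $\mathbb{Z}_n$, with group operation $(g_1(t),f_1(t))*(g_2(t),f_2(t))=(g_1(t)\,g_2(f_1(t)),\,f_2(f_1(t)))$ and identity $(1,t)$. $\mathcal{D}_n\cong\langle r_1,r_2\mid r_1^2=r_2^2=1,\ (r_1r_2)^n=1\rangle$. Fractions denote formal power series (series with constant term $1$ are invertible). *)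

(* Defs.v *)
From HB Require Import structures.
From mathcomp Require Import all_boot all_order all_algebra.
From mathcomp Require Import all_fingroup all_solvable.
From mathcomp Require Import boolp.

Set Implicit Arguments.
Unset Strict Implicit.
Unset Printing Implicit Defensive.

Import GRing.Theory.
Local Open Scope ring_scope.

(* Formal power series over R.  For R : comUnitRingType the instances below make
   fps R a comUnitRingType whose units are the series with invertible constant
   coefficient, so that x / y denotes the usual fraction for such y. *)
Record fps (R : Type) := FPS { fps_coef :> nat -> R }.

HB.instance Definition _ (R : Type) := gen_eqMixin (fps R).
HB.instance Definition _ (R : Type) := gen_choiceMixin (fps R).

Section PowerSeries.
Variable R : comUnitRingType.
Implicit Types x y z f : fps R.
Implicit Types p q r : {poly R}.

Lemma fpsP x y : (forall k, x k = y k) <-> x = y.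
Proof.
split=> [|-> //]; case: x => x; case: y => y /= e; congr FPS; exact: funext.
Qed.

Definition fps_zero : fps R := FPS (fun=> 0).
Definition fps_opp x : fps R := FPS (fun k => - x k).
Definition fps_add x y : fps R := FPS (fun k => x k + y k).

Fact fps_addA : associative fps_add.
Proof. by move=> x y z; apply/fpsP => k /=; rewrite addrA. Qed.
Fact fps_addC : commutative fps_add.
Proof. by move=> x y; apply/fpsP => k /=; rewrite addrC. Qed.
Fact fps_add0 : left_id fps_zero fps_add.
Proof. by move=> x; apply/fpsP => k /=; rewrite add0r. Qed.
Fact fps_addN : left_inverse fps_zero fps_opp fps_add.
Proof. by move=> x; apply/fpsP => k /=; rewrite addNr. Qed.

HB.instance Definition _ :=
  GRing.isZmodule.Build (fps R) fps_addA fps_addC fps_add0 fps_addN.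

Definition fpsC (c : R) : fps R := FPS (fun k => if k == 0%N then c else 0).
Definition fpsX : fps R := FPS (fun k => (k == 1%N)%:R).
Definition fps_mul x y : fps R :=
  FPS (fun k => \sum_(i < k.+1) x i * y (k - i)%N).

(* approx n x p : x = p modulo t^n; the ring laws and the properties of
   composition below are transferred from polynomials. *)
Definition approx n x p := forall k, (k < n)%N -> x k = p`_k.

Lemma approx_trunc n x : approx n x (\poly_(i < n) x i).
Proof. by move=> k kn; rewrite coef_poly kn. Qed.

Lemma approx_eq x y : (forall n, exists2 p, approx n x p & approx n y p) -> x = y.
Proof.
by move=> e; apply/fpsP => k; have [p px py] := e k.+1; rewrite px ?py.
Qed.

Lemma approxC n c : approx n (fpsC c) c%:P.
Proof. by move=> k _; rewrite coefC. Qed.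

Lemma approxX n : approx n fpsX 'X.
Proof. by move=> k _; rewrite coefX. Qed.

Lemma approx_add n x y p q :
  approx n x p -> approx n y q -> approx n (x + y) (p + q).
Proof. by move=> xp yq k kn; rewrite coefD -xp -?yq. Qed.

Lemma approx_mul n x y p q :
  approx n x p -> approx n y q -> approx n (fps_mul x y) (p * q).
Proof.
move=> xp yq k kn; rewrite coefM; apply: eq_bigr => i _.
rewrite xp ?yq //; first exact: leq_ltn_trans (leq_subr _ _) kn.
by apply: leq_trans (ltn_ord i) _.
Qed.

Fact fps_mulA : associative fps_mul.
Proof.
move=> x y z; apply: approx_eq => n.
exists ((\poly_(i < n) x i) * ((\poly_(i < n) y i) * (\poly_(i < n) z i))).
  by do !apply: approx_mul; apply: approx_trunc.
by rewrite mulrA; do !apply: approx_mul; apply: approx_trunc.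
Qed.
Fact fps_mulC : commutative fps_mul.
Proof.
move=> x y; apply: approx_eq => n.
exists ((\poly_(i < n) x i) * (\poly_(i < n) y i)); last rewrite mulrC;
  by apply: approx_mul; apply: approx_trunc.
Qed.
Fact fps_mul1 : left_id (fpsC 1) fps_mul.
Proof.
move=> x; apply: approx_eq => n; exists (\poly_(i < n) x i); last first.
  exact: approx_trunc.
by rewrite -[X in approx _ _ X]mul1r; apply: approx_mul; [apply: approxC | apply: approx_trunc].
Qed.
Fact fps_mulDl : left_distributive fps_mul fps_add.
Proof.
move=> x y z; apply/fpsP => k /=; rewrite -big_split; apply: eq_bigr => i _ /=.
by rewrite mulrDl.
Qed.
Fact fps_oner_neq0 : fpsC 1 != 0.
Proof. by apply/eqP => /fpsP /(_ 0%N) /eqP; rewrite /= oner_eq0. Qed.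

HB.instance Definition _ := GRing.Zmodule_isComNzRing.Build (fps R)
  fps_mulA fps_mulC fps_mul1 fps_mulDl fps_oner_neq0.

(* Forward substitution: fps_solve A u is the solution x of the triangular
   system \sum_(i < k.+1) x i * A i k = u k, when every A k k is a unit. *)
Section Triangular.
Variables (A : nat -> nat -> R) (u : nat -> R).

Fixpoint solve_prefix n : seq R :=
  if n is m.+1 then
    let s := solve_prefix m in
    rcons s ((u m - \sum_(i < m) s`_i * A i m) / A m m)
  else [::].

Definition fps_solve : fps R := FPS (fun k => (solve_prefix k.+1)`_k).

Lemma size_solve_prefix n : size (solve_prefix n) = n.
Proof. by elim: n => //= n IHn; rewrite size_rcons IHn. Qed.

Lemma nth_solve_prefix n k : (k < n)%N -> (solve_prefix n)`_k = fps_solve k.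
Proof.
elim: n => // n IHn; rewrite ltnS leq_eqVlt => /predU1P[-> // | kn].
by rewrite /= nth_rcons size_solve_prefix kn IHn.
Qed.

Lemma fps_solveP k : A k k \is a GRing.unit ->
  \sum_(i < k.+1) fps_solve i * A i k = u k.
Proof.
move=> Au; rewrite big_ord_recr /= nth_rcons size_solve_prefix ltnn eqxx divrK //.
rewrite addrC; under eq_bigr => i _ do rewrite nth_solve_prefix //.
by rewrite subrK.
Qed.
End Triangular.

Definition fps_unit : {pred fps R} := fun x => x 0%N \is a GRing.unit.

Definition fps_inv x : fps R :=
  if x 0%N \is a GRing.unit
  then fps_solve (fun i k => x (k - i)%N) (fpsC 1) else x.

Fact fps_mulVx : {in fps_unit, left_inverse 1 fps_inv *%R}.
Proof.
move=> x; rewrite unfold_in /fps_unit /fps_inv => ux; rewrite ux.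
apply/fpsP => k; apply: (@fps_solveP (fun i k => x (k - i)%N)).
by rewrite subnn.
Qed.
Fact fps_unitPl x y : y * x = 1 -> fps_unit x.
Proof.
move=> /fpsP /(_ 0%N) /=; rewrite big_ord_recl big_ord0 addr0 /= => e.
by apply/unitrPr; exists (y 0%N); rewrite mulrC.
Qed.
Fact fps_inv_out : {in [predC fps_unit], fps_inv =1 id}.
Proof.
by move=> x; rewrite !inE unfold_in /fps_unit /fps_inv => /negPf ->.
Qed.

HB.instance Definition _ := GRing.ComNzRing_hasMulInverse.Build (fps R)
  fps_mulVx fps_unitPl fps_inv_out.

(* x(f(t)), meaningful only when f 0 = 0: then f ^+ i has no term of degree
   less than i, so the coefficient of t^k only involves i <= k. *)
Definition fps_comp x f : fps R :=
  FPS (fun k => \sum_(i < k.+1) x i * (f ^+ i) k).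

Lemma approx_exp n x p m : approx n x p -> approx n (x ^+ m) (p ^+ m).
Proof.
move=> xp; elim: m => [|m IHm]; first exact: approxC.
by rewrite !exprS; apply: approx_mul.
Qed.

Lemma coef_expX_lt q i k : q`_0 = 0 -> (k < i)%N -> (q ^+ i)`_k = 0.
Proof.
move=> q0 ki; have /factor_theorem[r ->] : root q 0.
  by rewrite /root horner_coef0 q0.
by rewrite subr0 exprMn coefMXn ki.
Qed.

Lemma approx_comp n x f p q : f 0%N = 0 ->
  approx n x p -> approx n f q -> approx n (fps_comp x f) (p \Po q).
Proof.
move=> f0 xp fq k kn; have q0 : q`_0 = 0.
  by rewrite -fq // (leq_ltn_trans _ kn).
rewrite coef_comp_poly /=.
transitivity (\sum_(i < k.+1) p`_i * (q ^+ i)`_k).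
  apply: eq_bigr => i _; rewrite xp ?(leq_trans (ltn_ord i)) //.
  by rewrite (approx_exp _ fq).
rewrite (big_ord_widen (maxn k.+1 (size p)) (fun i => p`_i * (q ^+ i)`_k)) ?leq_maxl //.
rewrite [RHS](big_ord_widen (maxn k.+1 (size p)) (fun i => p`_i * (q ^+ i)`_k)) ?leq_maxr //.
rewrite big_mkcond [RHS]big_mkcond; apply: eq_bigr => i _.
case: ltnP => ik; case: ltnP => ip //; first by rewrite nth_default ?mul0r.
by rewrite coef_expX_lt ?mulr0.
Qed.

Lemma fps_comp_coef0 x f : (fps_comp x f) 0%N = x 0%N.
Proof. by rewrite /= big_ord_recl big_ord0 addr0 expr0 /= mulr1. Qed.

Lemma fps_comp_coef1 x f : (fps_comp x f) 1%N = x 1%N * f 1%N.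
Proof.
by rewrite /= !big_ord_recl big_ord0 addr0 expr0 expr1 /= mulr0 add0r.
Qed.

Lemma fps_mul_coef0 x y : (x * y) 0%N = x 0%N * y 0%N.
Proof. by rewrite /= big_ord_recl big_ord0 addr0. Qed.

Lemma fps_compC c f : f 0%N = 0 -> fps_comp (fpsC c) f = fpsC c.
Proof.
move=> f0; apply: approx_eq => n; exists c%:P; last exact: approxC.
rewrite -(comp_polyC c (\poly_(i < n) f i)).
by apply: approx_comp => //; [apply: approxC | apply: approx_trunc].
Qed.

Lemma fps_compX f : f 0%N = 0 -> fps_comp fpsX f = f.
Proof.
move=> f0; apply: approx_eq => n; exists (\poly_(i < n) f i); last first.
  exact: approx_trunc.
rewrite -[X in approx _ _ X]comp_polyX.
by apply: approx_comp => //; [apply: approxX | apply: approx_trunc].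
Qed.

Lemma fps_comp_id x : fps_comp x fpsX = x.
Proof.
apply: approx_eq => n; exists (\poly_(i < n) x i); last exact: approx_trunc.
rewrite -[X in approx _ _ X]comp_polyXr.
by apply: approx_comp => //; [apply: approx_trunc | apply: approxX].
Qed.

Lemma fps_compM x y f : f 0%N = 0 ->
  fps_comp (x * y) f = fps_comp x f * fps_comp y f.
Proof.
move=> f0; apply: approx_eq => n.
exists (((\poly_(i < n) x i) * (\poly_(i < n) y i)) \Po (\poly_(i < n) f i)).
  apply: approx_comp => //; last exact: approx_trunc.
  by apply: approx_mul; apply: approx_trunc.
rewrite comp_polyM.
by apply: approx_mul; apply: approx_comp => //; apply: approx_trunc.
Qed.

Lemma fps_compA x y f : y 0%N = 0 -> f 0%N = 0 ->
  fps_comp (fps_comp x y) f = fps_comp x (fps_comp y f).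
Proof.
move=> y0 f0; apply: approx_eq => n.
exists (((\poly_(i < n) x i) \Po (\poly_(i < n) y i)) \Po (\poly_(i < n) f i)).
  apply: approx_comp => //; last exact: approx_trunc.
  by apply: approx_comp => //; apply: approx_trunc.
rewrite -comp_polyA; apply: approx_comp; first by rewrite fps_comp_coef0.
  exact: approx_trunc.
by apply: approx_comp => //; apply: approx_trunc.
Qed.

Lemma fps_exp_diag f i : f 0%N = 0 -> (f ^+ i) i = f 1%N ^+ i.
Proof.
move=> f0; rewrite (approx_exp i (@approx_trunc i.+2 f)) //.
set q := \poly_(i < _) _.
have /factor_theorem[r q_r] : root q 0.
  by rewrite /root horner_coef0 coef_poly f0.
have -> : f 1%N = r`_0.
  by rewrite (@approx_trunc i.+2 f 1%N) // -/q q_r subr0 coefMX.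
by rewrite q_r subr0 exprMn coefMXn ltnn subnn -!horner_coef0 hornerE.
Qed.

Definition fps_comp_solve f (u : fps R) : fps R := fps_solve (fun i k => (f ^+ i) k) u.

Lemma fps_comp_solveK f (u : fps R) : f 0%N = 0 -> f 1%N \is a GRing.unit ->
  fps_comp (fps_comp_solve f u) f = u.
Proof.
move=> f0 f1; apply/fpsP => k.
apply: (@fps_solveP (fun i k => (f ^+ i) k)).
by rewrite fps_exp_diag ?unitrX.
Qed.

End PowerSeries.

Notation "c %:S" := (fpsC c) (at level 2, left associativity, format "c %:S")
  : ring_scope.
Notation "''t'" := (fpsX _) (at level 0) : ring_scope.

Section Riordan.
Variable R : comUnitRingType.

(* f'(0) is the coefficient of t in f. *)
Definition riordan_pred (gf : fps R * fps R) : bool :=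
  [&& gf.1 0%N \is a GRing.unit, gf.2 0%N == 0 & gf.2 1%N \is a GRing.unit].

Record riordan := Riordan {
  riordan_val :> fps R * fps R;
  _ : riordan_pred riordan_val }.

HB.instance Definition _ := [isSub for riordan_val].
HB.instance Definition _ := [Choice of riordan by <:].

Implicit Types x y z : riordan.

Lemma riordanP x : [/\ x.1 0%N \is a GRing.unit, x.2 0%N = 0
                     & x.2 1%N \is a GRing.unit].
Proof. by case: x => x /= /and3P[? /eqP ? ?]. Qed.

Fact riordan_one_subproof : riordan_pred (1, 't).
Proof. by rewrite /riordan_pred /= !unitr1 eqxx. Qed.
Definition riordan_one := Riordan riordan_one_subproof.

Fact riordan_mul_subproof x y :
  riordan_pred (x.1 * fps_comp y.1 x.2, fps_comp y.2 x.2).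
Proof.
have [ux fx vx] := riordanP x; have [uy fy vy] := riordanP y.
rewrite /riordan_pred [_.1]/= [_.2]/= fps_mul_coef0 !fps_comp_coef0.
by rewrite fps_comp_coef1 fy eqxx !unitrM ux uy vx vy.
Qed.
Definition riordan_mul x y := Riordan (riordan_mul_subproof x y).

Fact riordan_inv_subproof x :
  riordan_pred (fps_comp_solve x.2 (x.1)^-1, fps_comp_solve x.2 't).
Proof.
have [ux fx vx] := riordanP x.
have e1 := fps_comp_solveK (x.1)^-1 fx vx.
have e2 := fps_comp_solveK 't fx vx.
rewrite /riordan_pred [_.1]/= [_.2]/=; apply/and3P; split.
- rewrite -(fps_comp_coef0 _ x.2) e1.
  have : x.1 \is a GRing.unit := ux.
  by rewrite -unitrV => uV; exact: uV.
- by rewrite -(fps_comp_coef0 _ x.2) e2.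
- have := congr1 (fun y : fps R => y 1%N) e2.
  rewrite fps_comp_coef1 /= => e.
  by apply/unitrPr; exists (x.2 1%N).
Qed.
Definition riordan_inv x := Riordan (riordan_inv_subproof x).

Fact riordan_mulA : associative riordan_mul.
Proof.
move=> x y z; have [_ fx _] := riordanP x; have [_ fy _] := riordanP y.
apply/val_inj; congr (_, _) => /=; first by rewrite fps_compM // mulrA fps_compA.
by rewrite fps_compA.
Qed.
Fact riordan_mul1g : left_id riordan_one riordan_mul.
Proof.
move=> [[g f] p]; apply/val_inj; congr (_, _); rewrite /= fps_comp_id //.
by rewrite mul1r.
Qed.
Fact riordan_mulg1 : right_id riordan_one riordan_mul.
Proof.
move=> x; have [_ fx _] := riordanP x; apply/val_inj => /=.
rewrite (fps_compC 1 fx) fps_compX // mulr1.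
by case: (riordan_val x).
Qed.
Fact riordan_mulgV : right_inverse riordan_one riordan_inv riordan_mul.
Proof.
move=> x; have [ux fx vx] := riordanP x; apply/val_inj; congr (_, _) => /=.
  by rewrite fps_comp_solveK // divrr.
by rewrite fps_comp_solveK.
Qed.
Fact riordan_mulVg : left_inverse riordan_one riordan_inv riordan_mul.
Proof.
move=> x; rewrite -[LHS]riordan_mulg1 -(riordan_mulgV (riordan_inv x)).
rewrite riordan_mulA -(riordan_mulA (riordan_inv x)) riordan_mulgV.
by rewrite riordan_mulg1.
Qed.

HB.instance Definition _ := isGroup.Build riordan
  riordan_mulA riordan_mul1g riordan_mulg1 riordan_mulVg riordan_mulgV.

End Riordan.

(* <<A>> of fingroup needs a finite ambient group; the Riordan group is
   infinite. *)
Section GeneratedSubgroup.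
Variables (G : groupType) (A : {pred G}).
Local Open Scope group_scope.

Definition in_gen_subgroup : {pred G} := fun x =>
  `[< forall S : {pred G}, group_closed S -> {subset A <= S} -> x \in S >].

Record gen_subgroup := GenSubgroup {
  gen_subgroup_val :> G;
  _ : in_gen_subgroup gen_subgroup_val }.

HB.instance Definition _ := [isSub for gen_subgroup_val].
HB.instance Definition _ := [Choice of gen_subgroup by <:].

Fact in_gen_subgroup_group_closed : group_closed in_gen_subgroup.
Proof.
split=> [|x y]; rewrite !unfold_in.
  by apply/asboolP => S [].
move=> /asboolP xA /asboolP yA; apply/asboolP => S clS AS.
by have [_ divS] := clS; apply: divS; [apply: xA | apply: yA].
Qed.

HB.instance Definition _ :=
  SubChoice_isSubGroup.Build G in_gen_subgroup gen_subgroup in_gen_subgroup_group_closed.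

End GeneratedSubgroup.

Definition group_isomorphic (G H : groupType) : Prop :=
  exists f : {multiplicative G -> H}, bijective f.

(* Main.v *)
(* The elements (w/(1+kt)^s, ut/(1+kt)) multiply by
   (w, u, k) * (w', u', k') = (ww', uu', k + uk').  Hence r1 and r2 are involutions, and
   (r1 r2)^k = (1/(1+kt)^s, t/(1+kt)) is trivial iff n divides k.  Two involutions x, y
   whose product has order n > 2 generate a dihedral group: every element has a unique
   normal form (xy)^i x^e, since x = (xy)^i would make x and xy commute and so give
   (xy)^2 = 1. *)
From HB Require Import structures.
Require Import Defs.
From mathcomp Require Import all_boot all_order all_algebra.
From mathcomp Require Import all_fingroup all_solvable.
From mathcomp Require Import boolp.

Set Implicit Arguments.
Unset Strict Implicit.
Unset Printing Implicit Defensive.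

Import GRing.Theory.
Local Open Scope ring_scope.

(** For [n] at most 1 the type ['Z_n] is ['I_2], so the bound on [n] is what makes this reduction
    modulo [n]. *)
Lemma Zn_nat_eq0 n m : (1 < n)%N -> (m%:R == 0 :> 'Z_n) = (n %| m)%N.
Proof. by move=> n_gt1; rewrite -val_eqE /= val_Zp_nat. Qed.

(** * Normal forms in a group generated by two involutions *)

Section DihedralNormalForm.
Variables (n : nat) (G : groupType) (x y : G).
Hypotheses (n_gt1 : (1 < n)%N) (x2 : (x ^+ 2 = 1)%g) (y2 : (y ^+ 2 = 1)%g).
Hypothesis xyn : ((x * y) ^+ n = 1)%g.

(** The exponent of [x * y] is the representative of [p.1] below [n]. The indices do not depend on
    the group, so two groups can be matched word by word. *)
Definition dihedral_word (p : 'Z_n * bool) : G := ((x * y) ^+ p.1 * x ^+ p.2)%g.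

(** The law of the semidirect product of Z_n by Z_2 acting by inversion: moving [x] across a power
    of [x * y] inverts that power. *)
Definition dihedral_mul (p q : 'Z_n * bool) : 'Z_n * bool :=
  (p.1 + (if p.2 then - q.1 else q.1), p.2 (+) q.2).

Definition dihedral_inv (p : 'Z_n * bool) : 'Z_n * bool :=
  (if p.2 then p.1 else - p.1, p.2).

(** Conjugation by [x] turns [x * y] into [y * x], which is its inverse because both factors are
    involutions. *)
Lemma involutions_conj_expg i : (x * (x * y) ^+ i = ((x * y) ^+ i)^-1 * x)%g.
Proof.
have xV : (x^-1 = x)%g by apply: (mulgI x); rewrite mulgV -expg2 x2.
have yV : (y^-1 = y)%g by apply: (mulgI y); rewrite mulgV -expg2 y2.
elim: i => [|i IHi]; first by rewrite expg0 invg1 mulg1 mul1g.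
rewrite expgSr mulgA IHi -expgSr expgS !invMg xV yV.
by rewrite -!mulgA -expg2 x2 mulg1 (mulgA x) -expg2 x2 mul1g.
Qed.

Lemma expg_Zn_nat i : ((x * y) ^+ (i%:R : 'Z_n)%R = (x * y) ^+ i)%g.
Proof.
rewrite val_Zp_nat // {2}(divn_eq i n) expgnDr mulnC expgnA.
by rewrite xyn expg1n mul1g.
Qed.

Lemma expg_ZnD (i j : 'Z_n) :
  ((x * y) ^+ (i + j)%R = (x * y) ^+ i * (x * y) ^+ j)%g.
Proof. by rewrite -expgnDr -[in RHS]expg_Zn_nat natrD !natr_Zp. Qed.

Lemma expg_ZnN (i : 'Z_n) : ((x * y) ^+ (- i)%R = ((x * y) ^+ i)^-1)%g.
Proof. by apply: (mulgI ((x * y) ^+ i)%g); rewrite -expg_ZnD subrr mulgV. Qed.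

Lemma dihedral_wordM : {morph dihedral_word : p q / dihedral_mul p q >-> (p * q)%g}.
Proof.
case=> i e [j d]; rewrite /dihedral_mul /dihedral_word.
transitivity ((x * y) ^+ (i + (if e then - j else j))%R * x ^+ (e (+) d))%g => //.
rewrite expg_ZnD -!mulgA; congr (_ * _)%g; case: e => /=; last by rewrite mul1g.
rewrite expg_ZnN mulgA involutions_conj_expg -mulgA; congr (_ * _)%g.
by case: d; rewrite ?mulg1 // -expg2 x2.
Qed.

Lemma dihedral_wordV p : dihedral_word (dihedral_inv p) = (dihedral_word p)^-1%g.
Proof.
apply: (mulgI (dihedral_word p)); rewrite mulgV -dihedral_wordM.
suff -> : dihedral_mul p (dihedral_inv p) = (0, false) by rewrite /dihedral_word mulg1.
by case: p => i [|]; apply/eqP; rewrite xpair_eqE subrr.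
Qed.

Lemma dihedral_word_mem p : dihedral_word p \in in_gen_subgroup (pred2 x y).
Proof.
rewrite unfold_in; apply/asboolP => S [S1 divS] subS.
have VS u : u \in S -> (u^-1 \in S)%g by move=> Su; rewrite -div1g divS.
have MS u v : u \in S -> v \in S -> (u * v \in S)%g.
  by move=> Su Sv; rewrite -[v]invgK divS ?VS.
have XS u i : u \in S -> (u ^+ i \in S)%g.
  by move=> Su; elim: i => // i IHi; rewrite expgS MS.
by rewrite MS ?XS ?MS // subS // !inE eqxx ?orbT.
Qed.

(** The words form a set closed under quotients that contains [x] and [y], so minimality of the
    generated subgroup applies. *)
Lemma dihedral_word_surj g :
  g \in in_gen_subgroup (pred2 x y) -> exists p, dihedral_word p = g.
Proof.
rewrite unfold_in => /asboolP gen_g.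
apply/asboolP; apply: (gen_g (fun h => `[< exists p, dihedral_word p = h >])).
  split=> [|_ _ /asboolP[p <-] /asboolP[q <-]]; apply/asboolP.
    by exists (0, false); rewrite /dihedral_word mulg1.
  by exists (dihedral_mul p (dihedral_inv q)); rewrite dihedral_wordM dihedral_wordV.
move=> _ /orP[] /eqP->; apply/asboolP.
  by exists (0, true); rewrite /dihedral_word mul1g.
(* [y] is obtained as [x] times [x * y]. *)
exists (dihedral_mul (0, true) (1, false)); rewrite dihedral_wordM /dihedral_word.
rewrite mul1g mulg1 -[1]/(1%:R) expg_Zn_nat !expg1.
by rewrite mulgA -expg2 x2 mul1g.
Qed.

Lemma dihedral_word_inj : (2 < n)%N ->
  (forall k, (x * y) ^+ k = 1 -> (n %| k)%N)%g -> injective dihedral_word.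
Proof.
move=> n_gt2 ord.
have n_dvd (k : 'Z_n) : ((x * y) ^+ k = 1)%g -> k = 0.
  by move/ord=> nk; rewrite -(natr_Zp k); apply/eqP; rewrite Zn_nat_eq0.
have x_notin (k : 'Z_n) : ((x * y) ^+ k * x <> 1)%g.
  move=> zkx; have /ord/(dvdn_leq (isT : 0 < 2)%N) : ((x * y) ^+ 2 = 1)%g.
    have xE : x = ((x * y) ^+ k)^-1%g.
      by apply: (mulgI ((x * y) ^+ k)%g); rewrite zkx mulgV.
    have : commute (x * y)%g ((x * y) ^+ k)^-1%g by apply/commuteV/commuteX.
    (* Conjugation by [x] inverts [x * y] but also fixes it here, so [x * y] is its own inverse. *)
    rewrite -xE => cxz; have := involutions_conj_expg 1; rewrite !expg1 -cxz.
    by move/mulIg => zV; rewrite expg2 [X in (X * _)%g]zV mulVg.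
  by rewrite leqNgt n_gt2.
(* A quotient of two words is again a word, so only words equal to 1 have to be examined. *)
suff ker p : dihedral_word p = 1%g -> p = (0, false).
  move=> [i e] [j d] /(congr1 (fun h => h * (dihedral_word (j, d))^-1)%g).
  rewrite mulgV -dihedral_wordV -dihedral_wordM => /ker.
  by case: e d => [] [] // => /(congr1 fst)/subr0_eq /= ->.
case: p => i [|]; rewrite /dihedral_word; first by move/x_notin.
by rewrite mulg1 => /n_dvd /= ->.
Qed.
End DihedralNormalForm.

(** * Isomorphism with the dihedral group *)

Lemma group_isomorphic_morph (G H : groupType) (f : G -> H) :
  {morph f : x y / (x * y)%g} -> bijective f -> group_isomorphic G H.
Proof.
move=> fM bij_f; pose fMM := isMultiplicative.Build G H f fM.
pose F : {multiplicative G -> H} := HB.pack f fMM.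
by exists F.
Qed.

(** Both groups are parametrised by the same words with the same law [dihedral_mul]; the isomorphism
    matches elements with equal words. Uniqueness of words comes from [dihedral_word_inj] in [G] and
    from counting in the dihedral group. *)
Lemma involutions_gen_subgroup_dihedral (n : nat) (G : groupType) (x y : G) :
  (2 < n)%N -> (x ^+ 2 = 1)%g -> (y ^+ 2 = 1)%g ->
  (forall k, (x * y) ^+ k = 1 <-> (n %| k)%N)%g ->
  group_isomorphic (gen_subgroup (pred2 x y)) 'D_((2 * n)%N)%type.
Proof.
move=> n_gt2 x2 y2 ord; have n_gt1 := ltnW n_gt2.
have xyn : ((x * y) ^+ n = 1)%g by apply/ord.
have oxy k : ((x * y) ^+ k = 1 -> (n %| k)%N)%g by move/ord.
(* ['D_m] is indexed by its order, hence [n.*2] for n-fold symmetry. *)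
rewrite mul2n; set D := ('D_n.*2)%type.
(* The presentation, applied to [D] as an image of itself, yields involutions [u] and [v] that
   generate [D]. *)
have /existsP[[u v]] := etrans (esym (Grp'_dihedral n_gt1 _)) (homg_refl [set: D]).
rewrite /= => /eqP [defD u2 v2 uvn].
have surjD g : exists p, @dihedral_word n D u v p = g.
  apply/(dihedral_word_surj n_gt1 u2 v2 uvn).
  rewrite unfold_in; apply/asboolP => S [S1 divS] subS.
  have gS : group_set [set h in S].
    apply/group_setP; split=> [|h k]; rewrite !inE // => Sh Sk.
    by rewrite -[k]invgK divS // -div1g divS.
  have : g \in (<[u]> <*> <[v]>)%g by rewrite defD inE.
  suff /subsetP subD : (<[u]> <*> <[v]>)%g \subset Group gS by move/subD; rewrite inE.
  by rewrite join_subG !cycle_subG !inE !subS // !inE eqxx ?orbT.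
have /choice[w wK] := surjD.
have w_bij : bijective w.
  (* Being a section of the word map, [w] is injective; source and target both have 2n elements. *)
  apply: inj_card_bij; first exact: can_inj wK.
  by rewrite card_prod card_bool card_ord Zp_cast // -cardsT card_dihedral // muln2.
have wM : {morph w : g h / (g * h)%g >-> dihedral_mul g h}.
  move=> g h; apply: (bij_inj (bij_can_bij w_bij wK)).
  by rewrite dihedral_wordM // !wK.
(* [z h] is the element of [D] spelled in [u] and [v] by the word that spells [h] in [x] and [y]. *)
have /choice[z zK] (h : gen_subgroup (pred2 x y)) :
    exists g : D, dihedral_word x y (w g) = val h.
  have [p <-] := dihedral_word_surj n_gt1 x2 y2 xyn (valP h).
  by have [w' w'K wK'] := w_bij; exists (w' p); rewrite wK'.
have inj_xy := dihedral_word_inj n_gt1 x2 y2 xyn n_gt2 oxy.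
apply: (@group_isomorphic_morph _ _ z) => [h k|].
  apply: (bij_inj w_bij); apply: inj_xy.
  by rewrite wM dihedral_wordM // !zK.
exists (fun g => GenSubgroup (dihedral_word_mem x y (w g))) => [h | g].
  by apply: val_inj; rewrite /= zK.
by apply: (bij_inj w_bij); apply: inj_xy; rewrite zK.
Qed.

(** * Linear fractional elements of the Riordan group *)

Section LinearFractional.
Variable R : comUnitRingType.
Implicit Types (x y f : fps R) (c k w u : R).

Lemma fpsCM : {morph @fpsC R : c k / c * k}.
Proof.
move=> c k; apply/fpsP => -[|m]; first by rewrite fps_mul_coef0.
rewrite /= big_ord_recl /= mulr0 add0r big1 // => i _.
by rewrite mul0r.
Qed.

Lemma fpsCD : {morph @fpsC R : c k / c + k}.
Proof. by move=> c k; apply/fpsP => -[|m] //=; rewrite addr0. Qed.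

Lemma fps_compD x y f : f 0%N = 0 ->
  fps_comp (x + y) f = fps_comp x f + fps_comp y f.
Proof.
move=> f0; apply/fpsP => m /=; rewrite -big_split; apply: eq_bigr => i _.
by rewrite mulrDl.
Qed.

Lemma fps_comp1 f : f 0%N = 0 -> fps_comp 1 f = 1.
Proof. exact: fps_compC. Qed.

Lemma fps_compXn x f s : f 0%N = 0 -> fps_comp (x ^+ s) f = fps_comp x f ^+ s.
Proof.
move=> f0; elim: s => [|s IHs]; first by rewrite !expr0 fps_comp1.
by rewrite !exprS fps_compM // IHs.
Qed.

Lemma fps_unitE x : (x \is a GRing.unit) = (x 0%N \is a GRing.unit).
Proof. by []. Qed.

Lemma fps_mul_coef1 x y : x 0%N = 0 -> (x * y) 1%N = x 1%N * y 0%N.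
Proof. by move=> x0; rewrite /= !big_ord_recl big_ord0 /= x0 mul0r add0r addr0. Qed.

Lemma fpsX_mul_coefS x m : ('t * x) m.+1 = x m.
Proof.
rewrite /= !big_ord_recl big1 => [|i _]; last by rewrite mul0r.
by rewrite mul0r mul1r add0r addr0 subn1.
Qed.

Lemma fps_compV x f : f 0%N = 0 -> x \is a GRing.unit ->
  fps_comp x^-1 f = (fps_comp x f)^-1.
Proof.
move=> f0 ux; have uc : fps_comp x f \is a GRing.unit.
  by rewrite fps_unitE fps_comp_coef0.
by apply: (mulrI uc); rewrite -fps_compM // !divrr // fps_comp1.
Qed.

Definition lin_den k : fps R := 1 + k%:S * 't.

Lemma lin_den_unit k : lin_den k \is a GRing.unit.
Proof. by rewrite fps_unitE [_ 0%N]/= big_ord_recl big_ord0 /= mulr0 !addr0 unitr1. Qed.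

Definition lin_frac (s : nat) w u k : fps R * fps R :=
  (w%:S / lin_den k ^+ s, u%:S * 't / lin_den k).

Lemma lin_den0 : lin_den 0 = 1.
Proof.
rewrite /lin_den; suff -> : 0%:S = 0 :> fps R by rewrite mul0r addr0.
by apply/fpsP => -[].
Qed.

Lemma lin_frac_coef0 u k : (u%:S * 't / lin_den k) 0%N = 0.
Proof. by rewrite !fps_mul_coef0 /= mulr0 mul0r. Qed.

(** Put 1 + j ut/(1+kt) over the common denominator 1+kt. This is the source of the parameter
    [k + u * k'] in the product law. *)
Lemma lin_den_comp k u j :
  fps_comp (lin_den j) (u%:S * 't / lin_den k) = lin_den (k + u * j) / lin_den k.
Proof.
have f0 := lin_frac_coef0 u k; have uk := lin_den_unit k.
rewrite {1}/lin_den fps_compD // fps_comp1 // fps_compM // fps_compC // fps_compX //.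
rewrite -[X in X + _](divrr uk) !mulrA -mulrDl; congr (_ / _).
by rewrite /lin_den fpsCD fpsCM mulrDl addrA (mulrC u%:S).
Qed.

Lemma lin_frac_pred s w u k :
  w \is a GRing.unit -> u \is a GRing.unit -> riordan_pred (lin_frac s w u k).
Proof.
move=> uw uu; apply/and3P; split; last 1 first.
- change ((u%:S * 't / lin_den k) 1%N \is a GRing.unit).
  rewrite fps_mul_coef1; last by rewrite fps_mul_coef0 [X in _ * X]/= mulr0.
  by rewrite [u%:S * _]mulrC fps_mul_coef1 // mul1r unitrMl // -fps_unitE unitrV lin_den_unit.
- rewrite -fps_unitE unitrM unitrV unitrX ?lin_den_unit // andbT.
  by rewrite fps_unitE.
- by rewrite lin_frac_coef0.
Qed.

Lemma lin_frac_mul s w u k w' u' k' (r r' : riordan R) :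
  riordan_val r = lin_frac s w u k -> riordan_val r' = lin_frac s w' u' k' ->
  riordan_val (r * r')%g = lin_frac s (w * w') (u * u') (k + u * k').
Proof.
have f0 := lin_frac_coef0 u k; have ud := lin_den_unit.
move=> rE r'E; rewrite /= rE r'E /lin_frac [_.1]/= [_.2]/=.
rewrite !fps_compM // fps_compV ?unitrX // fps_compV // fps_compXn // !fps_compC //.
rewrite fps_compX // !lin_den_comp; congr (_, _).
  (* Substitution into the second factor produces (1+kt)^s in the numerator, which cancels the
     denominator of the first factor. *)
  rewrite fpsCM exprMn exprVn !invrM ?unitrV ?unitrX // invrK.
  rewrite -!mulrA; congr (_ * _); rewrite mulrCA; congr (_ * _).
  by rewrite mulrA mulVr ?unitrX // mul1r.
rewrite fpsCM invrM ?unitrV // invrK !mulrA.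
by rewrite divrK // (mulrC u'%:S).
Qed.

Lemma lin_frac_one (s : nat) : lin_frac s 1 1 0 = riordan_val (1 : riordan R)%g.
Proof. by rewrite /lin_frac lin_den0 expr1n !divr1 mul1r. Qed.

(** The first component need not determine [k]: modulo 4, (1+2t)^2 = 1. The second does, since t =
    t(1+kt) forces [k = 0]. *)
Lemma lin_frac_eq1 (s : nat) k : lin_frac s 1 1 k = lin_frac s 1 1 0 <-> k = 0.
Proof.
split=> [/(congr1 snd) fE | -> //].
move: fE; rewrite [LHS]/= [RHS]/= lin_den0 divr1 mul1r => fE.
have : 't = 't * lin_den k by rewrite -[in X in _ = X * _]fE divrK ?lin_den_unit.
(* The coefficient of t^2 is 0 on the left and [k] on the right. *)
move/fpsP/(_ 2); rewrite fpsX_mul_coefS /lin_den mulrC => /esym.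
rewrite -[LHS]/(0 + ('t * k%:S) 1%N) fpsX_mul_coefS add0r; exact.
Qed.
End LinearFractional.

Theorem theorem7 (n s a b : nat) (hn : (3 <= n)%N) (hs : (1 <= s)%N)
    (ha : (a < n)%N) (hb : (b < n)%N) (ha2 : a%:R ^+ 2 = 1 :> 'Z_n) :
  exists r1 r2 : riordan 'Z_n,
    [/\ riordan_val r1 =
          (a%:R%:S / (1 + (b + 1)%:R%:S * 't) ^+ s,
           (n - 1)%:R%:S * 't / (1 + (b + 1)%:R%:S * 't)),
        riordan_val r2 =
          (a%:R%:S / (1 + b%:R%:S * 't) ^+ s,
           (n - 1)%:R%:S * 't / (1 + b%:R%:S * 't))
      & group_isomorphic (gen_subgroup (pred2 r1 r2)) 'D_((2 * n)%N)%type].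
Proof.
have n_gt1 : (1 < n)%N := ltnW hn.
(* Both generators thus have u = -1, and [r c] below covers them with [c] equal to b+1 and b. *)
have nN1 : (n - 1)%:R = -1 :> 'Z_n.
  by rewrite natrB ?(ltnW n_gt1) // pchar_Zp // sub0r.
have aa : a%:R * a%:R = 1 :> 'Z_n by rewrite -expr2.
have ua : a%:R \is a @GRing.unit 'Z_n by apply/unitrPr; exists a%:R.
have uN1 : -1 \is a @GRing.unit 'Z_n by rewrite unitrN1.
pose r c := Riordan (lin_frac_pred s c ua uN1).
(* With u = -1 the parameters subtract, and the two signs and the two factors [a] cancel. Equal
   parameters make [r c] an involution. *)
have rr c d : riordan_val (r c * r d)%g = lin_frac s 1 1 (c - d).
  by rewrite (@lin_frac_mul _ s a%:R (-1) c a%:R (-1) d) // aa mulrNN mulr1 mulN1r.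
exists (r (b + 1)%:R), (r b%:R); split; [by rewrite nN1 | by rewrite nN1 |].
have r2 c : (r c ^+ 2 = 1)%g.
  by apply: val_inj; rewrite expg2 [LHS]rr subrr lin_frac_one.
apply: involutions_gen_subgroup_dihedral => // k.
(* The product of the generators has parameter (b+1) - b = 1 and u = 1, so each further factor adds
   1. *)
have zk : riordan_val ((r (b + 1)%:R * r b%:R) ^+ k)%g = lin_frac s 1 1 k%:R.
  elim: k => [|k IHk]; first by rewrite lin_frac_one.
  rewrite expgSr (lin_frac_mul IHk (rr _ _)) !mulr1 mul1r natrD addrAC subrr add0r.
  by rewrite -natrD addn1.
split=> [zk1 | nk].
  rewrite -Zn_nat_eq0 //; apply/eqP/(lin_frac_eq1 s).
  by rewrite -zk zk1 lin_frac_one.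
apply: val_inj; apply: etrans (lin_frac_one _ s).
rewrite [LHS]zk; apply/lin_frac_eq1/eqP.
by rewrite Zn_nat_eq0.
Qed.
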